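(* Let $f:\mathbb{R}^d\to\mathbb{R}$ be differentiable with minimum value $f^\ast$; let $L>0,\mu>0,\rho\ge1$. Assume (L-smooth) $f(x)-f(y)-\langle\nabla f(y),x-y\rangle\le\frac{L}{2}\|x-y\|^2$ for all $x,y$; (PL) $\|\nabla f(x)\|^2\ge2\mu(f(x)-f^\ast)$ for all $x$; (SGC) $\mathbb{E}_\xi[\nabla f(x,\xi)]=\nabla f(x)$ and $\mathbb{E}_\xi[\|\nabla f(x,\xi)\|^2]\le\rho\|\nabla f(x)\|^2$ for all $x$. Run the continuized Nesterov algorithm (see context) with $0<\gamma\le\frac{1}{\rho L}$, $\gamma'=\gamma+\sqrt{\frac{\gamma}{2\rho}}$, $\eta=\sqrt{\frac{\gamma}{2\rho}}$, $\eta'=\frac{\mu\gamma}{2}-\sqrt{\frac{\gamma}{2\rho}}$. Then for every $k\in\mathbb{N}$, $$\mathbb{E}\big[e^{\frac{\mu\gamma}{2}T_k}(f(\tilde x_k)-f^\ast)\big]\le f(x_0)-f^\ast.$$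
   Context: Stochastic gradients: $(\Xi,\mathcal{P})$ is a probability space and $\nabla f(x,\xi)$ is a measurable stochastic estimate of $\nabla f(x)$; $\mathbb{E}_\xi$ denotes integration in $\xi\sim\mathcal{P}$. Continuized Nesterov algorithm with parameters $(\eta,\eta',\gamma,\gamma')$, $\eta+\eta'>0$: let $T_0=0$ and $T_{k+1}-T_k$, $k\ge0$, i.i.d. exponential with parameter $1$; let $\xi_1,\xi_2,\dots$ be i.i.d. with law $\mathcal{P}$, independent of the $T_k$. Given deterministic $x_0$, set $\tilde x_0=\tilde z_0=x_0$ and, with $\Delta_k=T_{k+1}-T_k$, for $k\ge0$: $\tilde y_k=\tilde x_k+\frac{\eta}{\eta+\eta'}(1-e^{-(\eta+\eta')\Delta_k})(\tilde z_k-\tilde x_k)$, $\tilde x_{k+1}=\tilde y_k-\gamma\nabla f(\tilde y_k,\xi_{k+1})$, $\tilde z_{k+1}=\tilde z_k+\eta'\frac{1-e^{-(\eta+\eta')\Delta_k}}{\eta'+\eta e^{-(\eta+\eta')\Delta_k}}(\tilde y_k-\tilde z_k)-\gamma'\nabla f(\tilde y_k,\xi_{k+1})$. ($\tilde x_k$ coincides with the value $x_{T_k}$ of the associated continuized Nesterov process at the random time $T_k$.) *)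

(* Defs.v *)
From HB Require Import structures.
From mathcomp Require Import all_boot all_order all_algebra.
From mathcomp Require Import all_classical all_reals all_analysis.
Set Implicit Arguments. Unset Strict Implicit. Unset Printing Implicit Defensive.
Import Order.TTheory GRing.Theory Num.Theory.
Import numFieldNormedType.Exports.
Local Open Scope classical_set_scope.
Local Open Scope ring_scope.

Definition dotv {R : realType} {d : nat} (u v : 'rV[R]_d) : R :=
  \sum_(i < d) u 0 i * v 0 i.
Definition sqnorm {R : realType} {d : nat} (u : 'rV[R]_d) : R := dotv u u.

Definition is_gradient {R : realType} {d : nat}
  (f : 'rV[R]_d -> R) (gradf : 'rV[R]_d -> 'rV[R]_d) : Prop :=
  forall x, differentiable f x /\ forall v, 'D_v f x = dotv (gradf x) v.

(* Joint measurability of the stochastic gradient (x, xi) |-> G x xi, with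
   respect to the product of the Borel sigma-algebra of R^d and the
   sigma-algebra of Xi, expressed through the universal property of the
   product sigma-algebra. *)
Definition jointly_measurable {R : realType} {d : nat} {dX : measure_display}
  {Xi : measurableType dX} (G : 'rV[R]_d -> Xi -> 'rV[R]_d) : Prop :=
  forall (dY : measure_display) (Y : measurableType dY)
         (u : 'I_d -> Y -> R) (v : Y -> Xi),
    (forall i, measurable_fun setT (u i)) -> measurable_fun setT v ->
    forall j, measurable_fun setT (fun y => G (\row_i u i y) (v y) 0 j).

(* One step of the continuized Nesterov algorithm, from (x_k, z_k), with
   Delta = T_{k+1} - T_k and the sample xi = xi_{k+1}. *)
Definition cn_step {R : realType} {d : nat} {dX : measure_display}
  {Xi : measurableType dX} (G : 'rV[R]_d -> Xi -> 'rV[R]_d)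
  (eta eta' gam gam' : R) (Delta : R) (xi : Xi)
  (xz : 'rV[R]_d * 'rV[R]_d) : 'rV[R]_d * 'rV[R]_d :=
  let x := xz.1 in let z := xz.2 in
  let e := expR (- (eta + eta') * Delta) in
  let y := x + (eta / (eta + eta') * (1 - e)) *: (z - x) in
  let g := G y xi in
  (y - gam *: g,
   z + (eta' * (1 - e) / (eta' + eta * e)) *: (y - z) - gam' *: g).

(* (x~_k, z~_k) along the sample path: Delta i = T_{i+1} - T_i and
   xi i = xi_i (xi 0 is unused, the samples are xi 1, xi 2, ...). *)
Fixpoint cn_iter {R : realType} {d : nat} {dX : measure_display}
  {Xi : measurableType dX} (G : 'rV[R]_d -> Xi -> 'rV[R]_d)
  (eta eta' gam gam' : R) (Delta : nat -> R) (xi : nat -> Xi)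
  (x0 : 'rV[R]_d) (k : nat) : 'rV[R]_d * 'rV[R]_d :=
  match k with
  | 0 => (x0, x0)
  | k'.+1 => cn_step G eta eta' gam gam' (Delta k') (xi k'.+1)
               (cn_iter G eta eta' gam gam' Delta xi x0 k')
  end.

Definition arrival_time {R : realType} (Delta : nat -> R) (k : nat) : R :=
  \sum_(i < k) Delta i.

(* Mutual independence of the family (Delta_0, Delta_1, ..., xi_1, xi_2, ...):
   product rule for every finite subfamily (take A i = setT / B i = setT to
   drop indices). *)
Definition mutually_independent {d : measure_display} {Omega : measurableType d}
  {R : realType} (P : probability Omega R) {dX : measure_display}
  {Xi : measurableType dX} (Delta : nat -> Omega -> R) (xi : nat -> Omega -> Xi)
  : Prop :=
  forall (n : nat) (A : nat -> set R) (B : nat -> set Xi),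
    (forall i, measurable (A i)) -> (forall i, measurable (B i)) ->
    P ((\bigcap_(i in `I_n) (Delta i @^-1` A i)) `&`
       (\bigcap_(i in `I_n) (xi i.+1 @^-1` B i))) =
    ((\prod_(i < n) P (Delta i @^-1` A i)) *
     (\prod_(i < n) P (xi i.+1 @^-1` B i)))%E.

(* Main.v *)
(* Take the energy [lyapunov (x, z) = f x - fstar + |z - x|^2 / 2]. Between
   jumps [z - x] contracts like [exp (- m t)], [m = mu gam / 2], and [x] moves
   along a line; at a jump the cross terms in [<gradf y, z - x>] cancel against
   those of the flow, and L-smoothness, strong growth and the PL inequality
   absorb the remaining [|gradf y|^2]. Hence, writing [H t] for
   [exp ((m - 1) t)] times the energy along the flow, [- H'] dominates the
   exponential density times [exp (m t)] times the expected energy after a jump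
   at time [t]; integrating over [t >= 0] gives at most [H 0], so that
   [exp (m T_k)] times the energy has nonincreasing expectation.
   [f] is not assumed to be of class C^1: smoothness only bounds the curvature
   from above, but this already makes the derivative of [f] along a line
   continuous, which is what integrating [- H'] requires. *)
Require Import Defs.
From HB Require Import structures.
From mathcomp Require Import all_boot all_order all_algebra.
From mathcomp Require Import all_classical all_reals all_analysis.
From mathcomp Require Import measurable_realfun ring lra.
Set Implicit Arguments. Unset Strict Implicit. Unset Printing Implicit Defensive.
Import Order.TTheory GRing.Theory Num.Theory.
Import numFieldNormedType.Exports.
Local Open Scope classical_set_scope.
Local Open Scope ring_scope.

(** * Algebra of the inner product and the squared norm *)

Lemma dotvC (R : realType) (d : nat) (u v : 'rV[R]_d) : dotv u v = dotv v u.
Proof. by apply: eq_bigr => i _; rewrite mulrC. Qed.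

Lemma dotvDl (R : realType) (d : nat) (u v w : 'rV[R]_d) :
  dotv (u + v) w = dotv u w + dotv v w.
Proof. by rewrite -big_split; apply: eq_bigr => i _; rewrite !mxE mulrDl. Qed.

Lemma dotvZl (R : realType) (d : nat) (a : R) (u v : 'rV[R]_d) :
  dotv (a *: u) v = a * dotv u v.
Proof. by rewrite mulr_sumr; apply: eq_bigr => i _; rewrite !mxE mulrA. Qed.

Lemma dotvZr (R : realType) (d : nat) (a : R) (u v : 'rV[R]_d) :
  dotv u (a *: v) = a * dotv u v.
Proof. by rewrite dotvC dotvZl dotvC. Qed.

Lemma sqnorm_ge0 (R : realType) (d : nat) (u : 'rV[R]_d) : 0 <= sqnorm u.
Proof. by apply: sumr_ge0 => i _; rewrite -expr2 sqr_ge0. Qed.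

Lemma sqnormZ (R : realType) (d : nat) (a : R) (u : 'rV[R]_d) :
  sqnorm (a *: u) = a ^+ 2 * sqnorm u.
Proof. by rewrite /sqnorm dotvZl dotvZr mulrA. Qed.

Lemma sqnormBZ (R : realType) (d : nat) (a : R) (u v : 'rV[R]_d) :
  sqnorm (u - a *: v) = sqnorm u - 2 * a * dotv u v + a ^+ 2 * sqnorm v.
Proof.
rewrite -scaleNr /sqnorm dotvDl !(dotvC _ (u + _)) !dotvDl.
by rewrite !dotvZl !dotvZr (dotvC v u); ring.
Qed.

(** * One-variable calculus: restrictions to lines and integration of a derivative *)

(** The difference quotient of the restriction at [t] is literally that of [f] at [x + t *: v] in
    the direction [v]. *)
Lemma is_derive_along_line (R : realType) (d : nat) (f : 'rV[R]_d -> R)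
    (gradf : 'rV[R]_d -> 'rV[R]_d) (x v : 'rV[R]_d) (t : R) :
  is_gradient f gradf ->
  is_derive t 1 (fun r : R => f (x + r *: v)) (dotv (gradf (x + t *: v)) v).
Proof.
move=> /(_ (x + t *: v))[df Df].
have [dfv Dfv] : derivable f (x + t *: v) v /\ 'D_v f (x + t *: v) = dotv (gradf (x + t *: v)) v.
  by split; [exact: diff_derivable|exact: Df].
have E : (fun h : R => h^-1 *:
     (((fun r : R => f (x + r *: v)) \o shift t) (h *: 1) - f (x + t *: v))) =
   (fun h : R => h^-1 *: ((f \o shift (x + t *: v)) (h *: v) - f (x + t *: v))).
  apply/funext => h /=; congr (_ *: (f _ - _)).
  by rewrite [h%:A]mulr1 scalerDl; rewrite addrCA addrA addrC addrA.
apply: DeriveDef.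
  by rewrite /derivable E.
by rewrite -Dfv /derive E.
Qed.

Lemma is_derive_continuous (R : realType) (g g' : R -> R) :
  (forall t : R, is_derive t 1 g (g' t)) -> continuous g.
Proof.
move=> dg t; apply: differentiable_continuous; apply/derivable1_diffP.
exact: ex_derive.
Qed.

(* Applying the inequality at [t] with the fixed increments [e] and [-e]
   squeezes [g' t] between difference quotients of the continuous [g], up to
   [C * e]. *)
Lemma semiconcave_derive_continuous (R : realType) (g g' : R -> R) (C : R) :
  (forall t : R, is_derive t 1 g (g' t)) ->
  (forall s t, g s - g t - g' t * (s - t) <= C * (s - t) ^+ 2) ->
  continuous g'.
Proof.
move=> dg Hg t.
have cg := is_derive_continuous dg.
apply/cvgrPdist_le => /= e e0.
have [r r0 Hr] : exists2 r : R, 0 < r & forall k, 0 < `|k| -> `|k| < r ->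
    `|g (t + k) - g t - k * g' t| <= `|k| * (e / 4).
  have /cvgrPdist_le/(_ (e / 4)) : h^-1 *: (g (h *: 1 + t) - g t) @[h --> 0^'] --> g' t.
    by have dgt := dg t; rewrite -(@derive_val _ _ _ _ _ _ _ dgt); exact: ex_derive.
  case; first by lra.
  move=> r /= r0 Hr; exists r => // k k0 kr.
  have := Hr k; rewrite /ball_ /= sub0r normrN => /(_ kr) /(_ _).
  have kn0 : k != 0 by rewrite -normr_gt0.
  move=> /(_ kn0) /(ler_wpM2l (normr_ge0 k)).
  rewrite -normrM; congr (_ <= _); rewrite -[LHS]normrN; congr (`|_|).
  by rewrite [k *: 1]mulr1 (addrC k) /GRing.scale /=; field.
(* The bound [r / 2] keeps [h] and [- h] in the range of the derivative estimate at [t]; the other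
   bound gives [C * h ^+ 2 <= h * (e / 4)], the [+ 1] covering [C = 0]. The final error [h * e] is
   the sum of four quarters: this one, the derivative estimate, and the two moves of [g] from [s] to
   [t]. *)
pose h := Num.min (r / 2) (e / (4 * (`|C| + 1))).
have C1 : 0 < `|C| + 1 by rewrite ltr_wpDl.
have h0 : 0 < h by rewrite lt_min; apply/andP; split; apply: divr_gt0 => //; apply: mulr_gt0.
have hr : h < r by rewrite /h gt_min; apply/orP; left; lra.
have hC : C * h ^+ 2 <= h * (e / 4).
  rewrite expr2 mulrA mulrC ler_pM2l// (le_trans (ler_norm _))// normrM (gtr0_norm h0).
  rewrite (@le_trans _ _ ((`|C| + 1) * h))//; first by rewrite (ler_wpM2r (ltW h0))// lerDl.
  rewrite -ler_pdivlMl// (@le_trans _ _ (e / (4 * (`|C| + 1))))//.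
    by rewrite /h ge_min lexx orbT.
  by rewrite le_eqVlt; apply/orP; left; apply/eqP; field; rewrite gt_eqF.
have d0 : 0 < h * (e / 4) by apply: mulr_gt0 => //; lra.
have Hh := Hr h; have HNh := Hr (- h).
move: Hh HNh; rewrite normrN (gtr0_norm h0) => /(_ h0 hr) Hh /(_ h0 hr) HNh.
have near_g u : \forall s \near t, `|g (t + u) - g (s + u)| <= h * (e / 4).
  have : g (s + u) @[s --> t] --> g (t + u).
    by apply: (continuous_comp (f := fun s => s + u)); [exact: cvgD cvg_id (cvg_cst _)|exact: cg].
  by move=> /cvgrPdist_le/(_ _ d0).
near=> s.
have S0 : `|g (t + 0) - g (s + 0)| <= h * (e / 4) by near: s; exact: near_g.
have S1 : `|g (t + h) - g (s + h)| <= h * (e / 4) by near: s; exact: near_g.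
have S2 : `|g (t + - h) - g (s + - h)| <= h * (e / 4) by near: s; exact: near_g.
move: S0 S1 S2 Hh HNh; rewrite !addr0 !ler_norml.
move=> /andP[a1 a2] /andP[b1 b2] /andP[c1 c2] /andP[d1 d2] /andP[e1 e2].
have := Hg (s + h) s; have := Hg (s - h) s.
have -> : s - h - s = - h by ring.
have -> : s + h - s = h by ring.
rewrite sqrrN => P1 P2.
apply/andP; split; rewrite -(ler_pM2l h0); lra.
Unshelve. all: by end_near. Qed.

(** [H] decreases on the half-line and is bounded below, so it has a limit there, which is
    nonnegative. The fundamental theorem of calculus evaluates the integral as [H 0] minus this
    limit. *)
Lemma ge0_integral_Nderive_le (R : realType) (H h : R -> R) :
  (forall t : R, is_derive t 1 H (- h t)) -> continuous h ->
  (forall t, 0 <= t -> 0 <= h t) -> (forall t, 0 <= H t) ->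
  (\int[lebesgue_measure]_(t in `[0%R, +oo[) (h t)%:E <= (H 0)%:E)%E.
Proof.
move=> dH ch h0 H0.
have cH := is_derive_continuous dH.
have Hdecr x y : 0 <= x -> x <= y -> H y <= H x.
  move=> x0 xy; apply: (@ler0_derive1_le_cc _ H x y) => //.
  - move=> z; rewrite in_itv/= => /andP[/ltW xz _].
    by rewrite derive1E derive_val oppr_le0 h0// (le_trans x0).
  - exact: (@continuous_subspaceT _ _ _ H cH).
  - by rewrite in_itv/= lexx xy.
  - by rewrite in_itv/= lexx xy.
(* Freezing [H] on the negative half-line makes [g] monotone on the whole line, without changing it
   near infinity. *)
pose g x := - H (Num.max x 0).
have gle x : g x <= 0 by rewrite oppr_le0 H0// le_max lexx orbT.
have /nondecreasing_cvgr Hg : nondecreasing_fun g.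
  move=> x y xy; rewrite lerN2; apply: Hdecr; first by rewrite le_max lexx orbT.
  by rewrite ge_max !le_max xy lexx orbT.
have {}Hg : g x @[x --> +oo] --> sup (range g).
  by apply: Hg; exists 0 => _ [x _ <-].
have {Hg} Hl : - H x @[x --> +oo] --> sup (range g).
  apply: cvg_trans Hg; apply: near_eq_cvg; near=> x.
  by rewrite /g max_l.
have l0 : sup (range g) <= 0.
  by apply: ge_sup; [exists (g 0), 0|move=> _ [x _ <-]].
rewrite (@ge0_continuous_FTC2y _ _ (- H) _ (sup (range g))) //.
- by rewrite -EFinB lee_fin opprK; lra.
- by apply: continuous_subspaceT.
- by apply: cvgN; apply: cvg_at_right_filter; exact: cH.
- move=> x _; rewrite derive1E deriveN; last exact: ex_derive.
  by rewrite derive_val opprK.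
Unshelve. all: by end_near. Qed.

(** * Measurability of the iterates and of continuous functions of them *)

(** Reduces inversion to a real power, which is measurable. Squaring makes the base nonnegative, and
    the factor [x] restores the sign and gives the default value [0] at [0]. *)
Lemma inv_powR (R : realType) (x : R) : x^-1 = x * (x ^+ 2) `^ (-1).
Proof.
rewrite powR_inv1 ?sqr_ge0//; have [->|x0] := eqVneq x 0.
  by rewrite invr0 mul0r.
by field.
Qed.

Lemma measurable_funV d (T : measurableType d) (R : realType) (f : T -> R) :
  measurable_fun setT f -> measurable_fun setT (fun t => (f t)^-1).
Proof.
move=> mf; under eq_fun do rewrite inv_powR.
apply: measurable_funM => //.
exact: (measurableT_comp (measurable_powR (-1)) (measurable_funX 2 mf)).
Qed.

(** A preimage is a union of fibres of [q], indexed by natural numbers through [unpickle]; this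
    works for an arbitrary [g]. *)
Lemma measurable_fun_countable_valued dY (Y : measurableType dY) (R : realType)
    (T : countType) (q : Y -> T) (g : T -> R) :
  (forall k, measurable (q @^-1` [set k])) -> measurable_fun setT (g \o q).
Proof.
move=> mq _ A mA; rewrite setTI.
rewrite (_ : _ @^-1` A = \bigcup_n (if unpickle n is Some k then
    (if `[< A (g k) >] then q @^-1` [set k] else set0) else set0)).
  apply: bigcupT_measurable => n; case: unpickle => // k.
  by case: ifP.
apply/seteqP; split=> [y Ay|y [n _]].
  exists (pickle (q y)) => //; rewrite pickleK.
  by case: asboolP.
by case: unpickle => // k; case: asboolP => // Ak /= ->.
Qed.

(* Rounding every coordinate down to a multiple of [1 / (n + 1)] gives a
   countably valued approximation. *)
Lemma measurable_fun_continuous_row dY (Y : measurableType dY) (R : realType)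
    (d : nat) (f : 'rV[R]_d -> R) (u : Y -> 'rV[R]_d) :
  continuous f -> (forall i, measurable_fun setT (fun y => u y 0 i)) ->
  measurable_fun setT (f \o u).
Proof.
move=> cf mu.
pose q n y : {ffun 'I_d -> int} := [ffun i => Num.floor (n.+1%:R * u y 0 i)].
pose r n (k : {ffun 'I_d -> int}) : 'rV[R]_d := \row_i ((k i)%:~R / n.+1%:R).
apply: (@measurable_fun_cvg _ _ _ _ (fun n => (f \o r n) \o q n)).
  move=> n; apply: measurable_fun_countable_valued => k.
  (* A fibre of [q n] is cut out by finitely many half-open intervals, one for each coordinate. *)
  rewrite (_ : _ @^-1` _ = \bigcap_(i in [set: 'I_d])
      ((fun y => n.+1%:R * u y 0 i) @^-1` `[(k i)%:~R, (k i + 1)%:~R[)).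
    apply: fin_bigcap_measurable => [|i _]; first exact: finite_finset.
    rewrite -[X in measurable X]setTI.
    have : measurable_fun setT (fun y => n.+1%:R * u y 0 i).
      by apply: measurable_funM => //; exact: measurable_cst.
    by apply.
  apply/seteqP; split=> [y /= <- i _|y Hy].
    by rewrite /= ffunE in_itv/= floor_itv.
  apply/ffunP => i; rewrite ffunE; apply/floor_def.
  by have := Hy i Logic.I; rewrite /= in_itv.
move=> y _; apply: (@continuous_cvg _ _ _ _ _ (fun n => r n (q n y)) f); first exact: cf.
apply/cvg_ballP => e e0.
near=> n; split => // i j.
rewrite (ord1 i) !mxE ffunE /ball/= ger0_norm.
  have n0 : 0 < n.+1%:R :> R by [].
  rewrite -(ltr_pM2l n0) mulrBr [X in _ - X]mulrC divfK ?gt_eqF//.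
  rewrite (@lt_trans _ _ 1)//.
    by have := floorD1_gt (n.+1%:R * u y 0 j); rewrite intrD mulr1z ltrBlDl.
  rewrite -ltr_pdivrMl// mulr1.
  near: n; exact: (near_infty_natSinv_lt (PosNum e0)).
rewrite subr_ge0 ler_pdivrMr// [leRHS]mulrC; exact: floor_le.
Unshelve. all: by end_near. Qed.

Lemma measurable_fun_sqnorm dY (Y : measurableType dY) (R : realType) (d : nat)
    (u : Y -> 'rV[R]_d) :
  (forall i, measurable_fun setT (fun y => u y 0 i)) ->
  measurable_fun setT (fun y => sqnorm (u y)).
Proof. by move=> mu; apply: measurable_sum => i; exact: measurable_funM. Qed.

Lemma jointly_measurable_comp (R : realType) (d : nat) dX (Xi : measurableType dX)
    (G : 'rV[R]_d -> Xi -> 'rV[R]_d) dY (Y : measurableType dY)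
    (u : Y -> 'rV[R]_d) (v : Y -> Xi) (j : 'I_d) :
  jointly_measurable G ->
  (forall i, measurable_fun setT (fun y => u y 0 i)) -> measurable_fun setT v ->
  measurable_fun setT (fun y => G (u y) (v y) 0 j).
Proof.
move=> mG mu mv.
have -> : (fun y => G (u y) (v y) 0 j) = (fun y => G (\row_i u y 0 i) (v y) 0 j).
  by apply/funext => y; congr (G _ _ _ _); apply/rowP => i; rewrite mxE.
by apply: mG.
Qed.

Lemma measurable_cn_step (R : realType) (d : nat) dX (Xi : measurableType dX)
    (G : 'rV[R]_d -> Xi -> 'rV[R]_d) (eta eta' gam gam' : R)
    dY (Y : measurableType dY) (D : Y -> R) (v : Y -> Xi)
    (xz : Y -> 'rV[R]_d * 'rV[R]_d) (s : Y -> 'rV[R]_d * 'rV[R]_d) :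
  jointly_measurable G ->
  measurable_fun setT D -> measurable_fun setT v ->
  (forall i, measurable_fun setT (fun y => (xz y).1 0 i)) ->
  (forall i, measurable_fun setT (fun y => (xz y).2 0 i)) ->
  (forall y, s y = cn_step G eta eta' gam gam' (D y) (v y) (xz y)) ->
  (forall i, measurable_fun setT (fun y => (s y).1 0 i)) /\
  (forall i, measurable_fun setT (fun y => (s y).2 0 i)).
Proof.
move=> mG mD mv mx mz sE.
have mcst (c : R) : measurable_fun setT (fun _ : Y => c) by exact: measurable_cst.
have mM (g h : Y -> R) : measurable_fun setT g -> measurable_fun setT h ->
  measurable_fun setT (fun y => g y * h y) by exact: measurable_funM.
have mA (g h : Y -> R) : measurable_fun setT g -> measurable_fun setT h ->
  measurable_fun setT (fun y => g y + h y) by exact: measurable_funD.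
have mN (g : Y -> R) : measurable_fun setT g -> measurable_fun setT (fun y => - g y).
  exact: measurable_funN.
pose e y := expR (- (eta + eta') * D y).
have me : measurable_fun setT e.
  by apply: (measurableT_comp (@measurable_expR R)); apply: mM.
pose Yk y := (xz y).1 + (eta / (eta + eta') * (1 - e y)) *: ((xz y).2 - (xz y).1).
have mYk i : measurable_fun setT (fun y => Yk y 0 i).
  under eq_fun do rewrite !mxE.
  apply: (mA) => //; apply: (mM).
    apply: (mM) => //.
    by apply: (mA) => //; exact: mN.
  by apply: (mA) => //; exact: mN.
have mGk i : measurable_fun setT (fun y => G (Yk y) (v y) 0 i).
  exact: jointly_measurable_comp.
have s1 y i : (s y).1 0 i = Yk y 0 i - gam * G (Yk y) (v y) 0 i.
  by rewrite sE /= !mxE.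
have s2 y i : (s y).2 0 i = (xz y).2 0 i
    + eta' * (1 - e y) * (eta' + eta * e y)^-1 * (Yk y 0 i - (xz y).2 0 i)
    - gam' * G (Yk y) (v y) 0 i.
  by rewrite sE /= !mxE.
split=> i.
  under eq_fun do rewrite s1.
  by apply: (mA) => //; apply: mN; exact: mM.
under eq_fun do rewrite s2.
apply: (mA); last by apply: mN; exact: mM.
apply: (mA) => //; apply: (mM); last by apply: (mA) => //; exact: mN.
(* The denominator may vanish; inversion with value [0] at [0] is measurable on the whole line. *)
apply: (mM); last by apply: measurable_funV; apply: (mA) => //; exact: mM.
by apply: (mM) => //; apply: (mA) => //; exact: mN.
Qed.

(** * Independence of the past from the next waiting time and the next sample *)

(** By uniqueness of product measures, the product rule makes the joint law of [(X, W)] the product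
    of the law of [X] and [Q]; Tonelli then separates the two integrations. *)
Lemma integral_indep d1 d2 d3 (O : measurableType d1) (Y : measurableType d2)
    (S : measurableType d3) (R : realType) (P : probability O R)
    (Q : probability S R) (X : O -> Y) (W : O -> S) (F : Y * S -> \bar R) :
  measurable_fun setT X -> measurable_fun setT W ->
  (forall A B, measurable A -> measurable B ->
     P ((X @^-1` A) `&` (W @^-1` B)) = (P (X @^-1` A) * Q B)%E) ->
  measurable_fun setT F -> (forall p, (0 <= F p)%E) ->
  (\int[P]_w F (X w, W w) = \int[P]_w \int[Q]_s F (X w, s))%E.
Proof.
move=> mX mW XW mF F0.
pose X' : {mfun O >-> Y} := HB.pack X (isMeasurableFun.Build _ _ _ _ _ mX).
have mXW : measurable_fun setT (fun w => (X w, W w)) by exact: measurable_fun_pair.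
pose XW' : {mfun O >-> (Y * S)%type} :=
  HB.pack (fun w => (X w, W w)) (isMeasurableFun.Build _ _ _ _ _ mXW).
transitivity (\int[distribution P XW']_p F p)%E.
  by rewrite ge0_integral_distribution.
transitivity (\int[(distribution P X' \x Q)%E]_p F p)%E.
  apply: eq_measure_integral => A mA _; apply/esym/product_measure_unique => //.
rewrite fubini_tonelli1// ge0_integral_distribution//.
  exact: measurable_fun_fubini_tonelli_F.
by move=> y; apply: integral_ge0.
Qed.

(** As functions of [A], both sides are finite measures, a restriction and a multiple of [P]. They
    agree on the pi-system [E], hence on the sigma-algebra it generates. *)
Lemma indep_g_sigma_algebra d (O : measurableType d) (R : realType)
    (P : probability O R) (E : set (set O)) (W : set O) :
  E `<=` measurable -> setI_closed E -> E setT -> measurable W ->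
  (forall A, E A -> P (A `&` W) = (P A * P W)%E) ->
  forall A, <<s E >> A -> P (A `&` W) = (P A * P W)%E.
Proof.
move=> mE EI ET mW EW A EA.
have PW0 : 0 <= fine (P W) by apply: fine_ge0.
rewrite muleC -[P W]fineK ?fin_num_measure//.
apply: (@g_sigma_algebra_measure_unique _ _ _ E mE (fun=> setT) _ _
   (mrestr P mW) (mscale (NngNum PW0) P)) => //.
- by rewrite bigcup_const.
- move=> B EB; transitivity (P (B `&` W)) => //; rewrite EW// muleC.
  by rewrite /= /mscale /= fineK// fin_num_measure.
- by move=> _; have : (P (setT `&` W) < +oo)%E by rewrite setTI ltey_eq fin_num_measure.
Qed.

(* The finite-dimensional cylinders over [Delta 0, ..., Delta n.-1] and
   [xi 1, ..., xi m]: a pi-system generating their joint sigma-algebra. *)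
Definition past d (O : measurableType d) (R : realType) dX (Xi : measurableType dX)
    (Delta : nat -> O -> R) (xi : nat -> O -> Xi) (n m : nat) : set (set O) :=
  [set E | exists (A : nat -> set R) (B : nat -> set Xi),
    [/\ forall i, measurable (A i), forall i, measurable (B i) &
    E = (\bigcap_(i in `I_n) (Delta i @^-1` A i)) `&`
        (\bigcap_(i in `I_m) (xi i.+1 @^-1` B i))]].

Section past.
Context d (O : measurableType d) (R : realType) (P : probability O R).
Context dX (Xi : measurableType dX).
Variables (Delta : nat -> O -> R) (xi : nat -> O -> Xi).
Hypothesis mDelta : forall k, measurable_fun setT (Delta k).
Hypothesis mxi : forall k, measurable_fun setT (xi k.+1).

Lemma past_measurable n m : past Delta xi n m `<=` measurable.
Proof.
move=> _ [A [B [mA mB ->]]].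
apply: measurableI; apply: fin_bigcap_measurable => [|i _]; try exact: finite_II.
  by rewrite -[X in measurable X]setTI; exact: mDelta.
by rewrite -[X in measurable X]setTI; exact: mxi.
Qed.

Lemma past_setI_closed n m : setI_closed (past Delta xi n m).
Proof.
move=> _ _ [A [B [mA mB ->]]] [A' [B' [mA' mB' ->]]].
exists (fun i => A i `&` A' i), (fun i => B i `&` B' i); split=> [i|i|].
- exact: measurableI.
- exact: measurableI.
- by rewrite setIACA -!bigcapI.
Qed.

Lemma past_setT n m : past Delta xi n m setT.
Proof.
exists (fun=> setT), (fun=> setT); split=> //.
by apply/seteqP; split=> // w _; split=> i _.
Qed.

Lemma past_Delta n m i A : (i < n)%N -> measurable A ->
  past Delta xi n m (Delta i @^-1` A).
Proof.
move=> ni mA; exists (fun j => if j == i then A else setT), (fun=> setT); split=> //.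
  by move=> j; case: ifP.
apply/seteqP; split=> [w Aw|w [/(_ i ni)]]; last by rewrite /= eqxx.
by split=> j _ //=; case: eqP => // ->.
Qed.

Lemma past_xi n m i B : (i < m)%N -> measurable B ->
  past Delta xi n m (xi i.+1 @^-1` B).
Proof.
move=> mi mB; exists (fun=> setT), (fun j => if j == i then B else setT); split=> //.
  by move=> j; case: ifP.
apply/seteqP; split=> [w Bw|w [_ /(_ i mi)]]; last by rewrite /= eqxx.
by split=> j _ //=; case: eqP => // ->.
Qed.

(** The sample space under the coarser sigma-algebra of the past: to depend only on the past is to
    be measurable from this type. The two counts differ when [Delta n] is already known but the next
    sample is not. *)
Definition past_type n m : measurableType _ := g_sigma_algebraType (past Delta xi n m).

Lemma measurable_id_past n m :
  measurable_fun setT (fun w : O => w : past_type n m).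
Proof.
move=> _ A mA; rewrite setTI; move: mA; apply: smallest_sub; last exact: past_measurable.
exact: sigma_algebra_measurable.
Qed.

Lemma measurable_Delta_past n m i : (i < n)%N ->
  measurable_fun setT (Delta i : past_type n m -> R).
Proof.
by move=> ni _ A mA; rewrite setTI; apply: sub_sigma_algebra; exact: past_Delta.
Qed.

Lemma measurable_xi_past n m i : (i < m)%N ->
  measurable_fun setT (xi i.+1 : past_type n m -> Xi).
Proof.
by move=> mi _ A mA; rewrite setTI; apply: sub_sigma_algebra; exact: past_xi.
Qed.

Hypothesis indep : mutually_independent P Delta xi.

(** Both families are padded to the common length [maxn n m] by full sets, whose preimages have
    probability 1. *)
Lemma past_product n m (A : nat -> set R) (B : nat -> set Xi) :
  (forall i, measurable (A i)) -> (forall i, measurable (B i)) ->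
  P ((\bigcap_(i in `I_n) (Delta i @^-1` A i)) `&`
     (\bigcap_(i in `I_m) (xi i.+1 @^-1` B i))) =
  ((\prod_(i < n) P (Delta i @^-1` A i)) *
   (\prod_(i < m) P (xi i.+1 @^-1` B i)))%E.
Proof.
move=> mA mB; pose N := maxn n m.
have cap T (p : nat) (X : nat -> O -> T) (C : nat -> set T) : (p <= N)%N ->
    \bigcap_(i in `I_p) (X i @^-1` C i) =
    \bigcap_(i in `I_N) (X i @^-1` (if (i < p)%N then C i else setT)).
  move=> pN; apply/seteqP; split=> w Hw i /= iN.
    by case: ifP => // ip; exact: Hw.
  by have := Hw i (leq_trans iN pN); rewrite /= iN.
have prod T (p : nat) (X : nat -> O -> T) (C : nat -> set T) : (p <= N)%N ->
    (\prod_(i < p) P (X i @^-1` C i) =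
     \prod_(i < N) P (X i @^-1` (if (i < p)%N then C i else setT)))%E.
  move=> pN; rewrite (big_ord_widen N (fun i => P (X i @^-1` C i)) pN) big_mkcond.
  apply: eq_bigr => i _; case: ifP => // _.
  by rewrite preimage_setT probability_setT.
rewrite (cap _ n Delta A) ?leq_maxl// (cap _ m (fun i => xi i.+1) B) ?leq_maxr//.
rewrite (prod _ n Delta A) ?leq_maxl// (prod _ m (fun i => xi i.+1) B) ?leq_maxr//.
by apply: indep => i; case: ifP.
Qed.

(** It suffices to test cylinders. Intersecting one with a condition on [Delta n] gives a cylinder
    with one more factor, to which [past_product] applies. *)
Lemma past_indep_Delta n m E A : measurable (E : set (past_type n m)) -> measurable A ->
  P (E `&` Delta n @^-1` A) = (P E * P (Delta n @^-1` A))%E.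
Proof.
move=> + mA; apply: indep_g_sigma_algebra.
- exact: past_measurable.
- exact: past_setI_closed.
- exact: past_setT.
- by rewrite -[X in measurable X]setTI; exact: mDelta.
move=> _ [B [C [mB mC ->]]].
pose B' i := if i == n then A else B i.
have mB' i : measurable (B' i) by rewrite /B'; case: ifP.
rewrite (_ : _ `&` _ `&` _ = (\bigcap_(i in `I_n.+1) (Delta i @^-1` B' i)) `&`
    (\bigcap_(i in `I_m) (xi i.+1 @^-1` C i))); last first.
  rewrite setIAC; congr (_ `&` _); apply/seteqP; split=> [w [Bw Aw] i|w Bw].
    by rewrite /= ltnS leq_eqVlt /B'; case: eqP => [->//|_] /= /Bw.
  split=> [i /= i_n|]; last by have := Bw n (ltnSn n); rewrite /= /B' eqxx.
  by have := Bw i (leqW i_n); rewrite /= /B' ltn_eqF.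
rewrite !past_product// big_ord_recr /= {2}/B' eqxx muleAC.
by congr (_ * _ * _)%E; apply: eq_bigr => i _; rewrite /B' ltn_eqF.
Qed.

Lemma past_indep_xi n m E B : measurable (E : set (past_type n m)) -> measurable B ->
  P (E `&` xi m.+1 @^-1` B) = (P E * P (xi m.+1 @^-1` B))%E.
Proof.
move=> + mB; apply: indep_g_sigma_algebra.
- exact: past_measurable.
- exact: past_setI_closed.
- exact: past_setT.
- by rewrite -[X in measurable X]setTI; exact: mxi.
move=> _ [A [C [mA mC ->]]].
pose C' i := if i == m then B else C i.
have mC' i : measurable (C' i) by rewrite /C'; case: ifP.
rewrite (_ : _ `&` _ `&` _ = (\bigcap_(i in `I_n) (Delta i @^-1` A i)) `&`
    (\bigcap_(i in `I_m.+1) (xi i.+1 @^-1` C' i))); last first.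
  rewrite -setIA; congr (_ `&` _); apply/seteqP; split=> [w [Cw Bw] i|w Cw].
    by rewrite /= ltnS leq_eqVlt /C'; case: eqP => [->//|_] /= /Cw.
  split=> [i /= i_m|]; last by have := Cw m (ltnSn m); rewrite /= /C' eqxx.
  by have := Cw i (leqW i_m); rewrite /= /C' ltn_eqF.
rewrite !past_product// [in LHS]big_ord_recr /= {2}/C' eqxx -muleA.
by congr (_ * (_ * _))%E; apply: eq_bigr => i _; rewrite /C' ltn_eqF.
Qed.

End past.

(** * Expectations under a density, and of quadratic bounds *)

(** Having the same integrals over measurable sets, [p] and the Radon-Nikodym derivative of [nu]
    agree almost everywhere, and the change of variables for the latter carries over. *)
Lemma integral_density d (T : measurableType d) (R : realType)
    (mu : {sigma_finite_measure set T -> \bar R}) (nu : probability T R)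
    (p : T -> R) (F : T -> \bar R) :
  measurable_fun setT p -> (forall x, 0 <= p x) ->
  (forall A, measurable A -> nu A = \int[mu]_(x in A) (p x)%:E)%E ->
  measurable_fun setT F -> (forall x, (0 <= F x)%E) ->
  (\int[nu]_x F x = \int[mu]_x (F x * (p x)%:E))%E.
Proof.
move=> mp p0 nuE mF F0.
have mEp : measurable_fun setT (EFin \o p) by exact/measurable_EFinP.
have numu : nu `<< mu.
  apply/null_content_dominatesP => A mA muA0; rewrite nuE//.
  by apply: null_set_integral => //; exact: measurable_funTS.
have ip : mu.-integrable setT (EFin \o p).
  apply/integrableP; split => //.
  under eq_integral do rewrite /= ger0_norm//.
  by rewrite -nuE// probability_setT ltry.
rewrite -(Radon_Nikodym_SigmaFinite.change_of_variables numu)//.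
have mf := measurable_int _ (Radon_Nikodym_SigmaFinite.f_integrable numu).
apply: ae_eq_integral => //; [exact: emeasurable_funM|exact: emeasurable_funM|].
apply: ae_eqe_mul2l; apply/ae_eq_sym; apply: integral_ae_eq => //.
move=> A _ mA; rewrite -nuE//.
by rewrite (Radon_Nikodym_SigmaFinite.f_integral numu).
Qed.

Lemma integral_exponential (R : realType) (Q : probability (measurableTypeR R) R)
    (F : R -> \bar R) :
  (forall A : set R, measurable A -> Q A = exponential_prob 1 A) ->
  measurable_fun setT F -> (forall t, (0 <= F t)%E) ->
  (\int[Q]_t F t =
   \int[lebesgue_measure]_(t in `[0%R, +oo[) (F t * (expR (- t))%:E))%E.
Proof.
move=> QE mF F0.
rewrite (integral_density (mu := lebesgue_measure) (nu := Q) (p := exponential_pdf 1))//.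
- rewrite [RHS]integral_mkcond; apply: eq_integral => t _.
  rewrite /exponential_pdf /patch; case: ifP => _; last by rewrite mule0.
  by rewrite mul1r mulN1r.
- exact: measurable_exponential_pdf.
- by move=> t; exact: exponential_pdf_ge0.
Qed.

(** Taking expectations of the upper bound, the linear term sees only the mean [m] of [g], and
    [c >= 0] lets [M] replace the second moment. *)
Lemma integral_quadratic_le dX (Xi : measurableType dX) (R : realType) (d : nat)
    (P : probability Xi R) (g : Xi -> 'rV[R]_d) (m b : 'rV[R]_d) (A c M : R)
    (h : Xi -> R) :
  (forall j, P.-integrable setT (fun s => (g s 0 j)%:E) /\
     (\int[P]_s (g s 0 j)%:E = (m 0 j)%:E)%E) ->
  (\int[P]_s (sqnorm (g s))%:E <= M%:E)%E ->
  0 <= c -> measurable_fun setT h ->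
  (forall s, 0 <= h s <= A + dotv b (g s) + c * sqnorm (g s)) ->
  (\int[P]_s (h s)%:E <= (A + dotv b m + c * M)%:E)%E.
Proof.
move=> gm gM c0 mh hq.
have mg j : measurable_fun setT (fun s => g s 0 j).
  by apply/measurable_EFinP; exact: measurable_int (gm j).1.
have msq : measurable_fun setT (fun s => sqnorm (g s)) by exact: measurable_fun_sqnorm.
have isq : P.-integrable setT (fun s => (sqnorm (g s))%:E).
  apply/integrableP; split; first exact/measurable_EFinP.
  under eq_integral do rewrite /= ger0_norm ?sqnorm_ge0//.
  exact: le_lt_trans gM (ltry _).
have idot : P.-integrable setT (fun s => (dotv b (g s))%:E).
  rewrite (_ : (fun _ => _) = (fun s => \sum_(j < d) ((b 0 j)%:E * (g s 0 j)%:E)))%E.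
    by apply: integrable_sum => // j _; apply: integrableZl => //; exact: (gm j).1.
  by apply/funext => s; rewrite sumEFin.
have icst : P.-integrable setT (fun s => A%:E) by exact: finite_measure_integrable_cst.
have ic : P.-integrable setT (fun s => c%:E * (sqnorm (g s))%:E)%E by exact: integrableZl.
have iAd := integrableD measurableT icst idot.
apply: (@le_trans _ _ (\int[P]_s (A%:E + (dotv b (g s))%:E + c%:E * (sqnorm (g s))%:E))%E).
  apply: ge0_le_integral => //.
  - by move=> s _; case/andP: (hq s).
  - exact/measurable_EFinP.
  - exact: measurable_int (integrableD measurableT iAd ic).
  - by move=> s _; rewrite -EFinM -!EFinD lee_fin; case/andP: (hq s).
rewrite integralD// integralD// integral_cst//= probability_setT mule1 integralZl//.
rewrite !EFinD EFinM; apply: leeD; last by apply: lee_wpmul2l; rewrite ?lee_fin.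
apply: leeD => //.
rewrite (_ : (fun s => _) = (fun s => \sum_(j < d) ((b 0 j)%:E * (g s 0 j)%:E)))%E; last first.
  by apply/funext => s; rewrite sumEFin.
rewrite integral_sum//; last by move=> j; apply: integrableZl => //; exact: (gm j).1.
rewrite /dotv -sumEFin; apply: lee_sum => j _.
by rewrite integralZl ?(gm j).2//; exact: (gm j).1.
Qed.

(** * Decrease of the energy over one flow and jump *)

Section continuized_nesterov.
Context (R : realType) (d : nat) (f : 'rV[R]_d -> R) (gradf : 'rV[R]_d -> 'rV[R]_d).
Context (fstar L mu rho : R).
Context dX (Xi : measurableType dX) (PXi : probability Xi R).
Context (G : 'rV[R]_d -> Xi -> 'rV[R]_d) (gam : R).

Hypothesis gradient_f : is_gradient f gradf.
Hypothesis fstar_le : forall x, fstar <= f x.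
Hypotheses (L_gt0 : 0 < L) (mu_gt0 : 0 < mu) (rho_ge1 : 1 <= rho).
Hypothesis smooth :
  forall x y, f x - f y - dotv (gradf y) (x - y) <= L / 2 * sqnorm (x - y).
Hypothesis PL : forall x, sqnorm (gradf x) >= 2 * mu * (f x - fstar).
Hypothesis mG : jointly_measurable G.
Hypothesis unbiased : forall x j, PXi.-integrable setT (fun s => (G x s 0 j)%:E) /\
  (\int[PXi]_s (G x s 0 j)%:E = (gradf x 0 j)%:E)%E.
Hypothesis strong_growth :
  forall x, (\int[PXi]_s (sqnorm (G x s))%:E <= (rho * sqnorm (gradf x))%:E)%E.
Hypotheses (gam_gt0 : 0 < gam) (gam_le : gam <= 1 / (rho * L)).

Let eta := Num.sqrt (gam / (2 * rho)).
Let m := mu * gam / 2.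

Let rho_gt0 : 0 < rho. Proof. exact: lt_le_trans ltr01 rho_ge1. Qed.

Let eta_gt0 : 0 < eta.
Proof. by rewrite sqrtr_gt0 divr_gt0// mulr_gt0. Qed.

Let m_gt0 : 0 < m.
Proof. by rewrite divr_gt0// mulr_gt0. Qed.

Let eta2 : eta ^+ 2 * rho = gam / 2.
Proof.
rewrite sqr_sqrtr; last by rewrite ltW// divr_gt0// mulr_gt0.
by field; rewrite gt_eqF.
Qed.

Let continuous_f : continuous f.
Proof. by move=> x; apply: differentiable_continuous; have [] := gradient_f x. Qed.

Definition lyapunov (p : 'rV[R]_d * 'rV[R]_d) : R :=
  f p.1 - fstar + sqnorm (p.2 - p.1) / 2.

Lemma lyapunov_ge0 p : 0 <= lyapunov p.
Proof. by rewrite addr_ge0 ?subr_ge0// divr_ge0// sqnorm_ge0. Qed.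

Lemma measurable_lyapunov dY (Y : measurableType dY) (p : Y -> 'rV[R]_d * 'rV[R]_d) :
  (forall i, measurable_fun setT (fun y => (p y).1 0 i)) ->
  (forall i, measurable_fun setT (fun y => (p y).2 0 i)) ->
  measurable_fun setT (fun y => lyapunov (p y)).
Proof.
move=> m1 m2; apply: measurable_funD.
  apply: measurable_funB; last exact: measurable_cst.
  exact: (measurable_fun_continuous_row continuous_f m1).
apply: measurable_funM; last exact: measurable_cst.
apply: measurable_fun_sqnorm => i; under eq_fun do rewrite !mxE.
exact: measurable_funB.
Qed.

Lemma measurable_jump y v :
  measurable_fun setT
    (fun s => f (y - gam *: G y s) - fstar + sqnorm (v - eta *: G y s) / 2).
Proof.
have mGy j : measurable_fun setT (fun s => G y s 0 j).
  by apply: jointly_measurable_comp => // i; exact: measurable_cst.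
apply: measurable_funD.
  apply: measurable_funB; last exact: measurable_cst.
  apply: (measurable_fun_continuous_row (u := fun s => y - gam *: G y s) continuous_f) => i.
  under eq_fun do rewrite !mxE.
  apply: measurable_funB; first exact: measurable_cst.
  by apply: measurable_funM => //; exact: measurable_cst.
apply: measurable_funM; last exact: measurable_cst.
apply: measurable_fun_sqnorm => i; under eq_fun do rewrite !mxE.
apply: measurable_funB; first exact: measurable_cst.
by apply: measurable_funM => //; exact: measurable_cst.
Qed.

(** Here [y] is the position just before the jump and [v] the difference [z - x] there. The jump
    subtracts [eta *: G y s] from [v] because [gam' - gam = eta]. *)
Lemma expected_jump_le y v :
  (\int[PXi]_s (f (y - gam *: G y s) - fstar + sqnorm (v - eta *: G y s) / 2)%:E <=
   ((1 - m) * (f y - fstar) + sqnorm v / 2 - eta * dotv (gradf y) v)%:E)%E.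
Proof.
(* Coefficients of [G y s] in the bound on the energy after the jump, once smoothness is applied
   between [y - gam *: G y s] and [y]. *)
pose b := - gam *: gradf y + - eta *: v.
pose c := (L * gam ^+ 2 + eta ^+ 2) / 2.
have c0 : 0 <= c by rewrite divr_ge0// addr_ge0// ?sqr_ge0// mulr_ge0 ?sqr_ge0// ltW.
apply: le_trans (integral_quadratic_le (A := f y - fstar + sqnorm v / 2) (b := b)
  (unbiased y) (strong_growth y) c0 (measurable_jump y v) _) _.
  move=> s; apply/andP; split.
    by rewrite addr_ge0 ?subr_ge0// divr_ge0// sqnorm_ge0.
  have := smooth (y - gam *: G y s) y.
  rewrite (_ : y - gam *: G y s - y = - gam *: G y s); last by rewrite addrAC subrr add0r scaleNr.
  rewrite sqnormZ dotvZr sqnormBZ /b dotvDl !dotvZl /c sqrrN => H.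
  by lra.
rewrite lee_fin /b dotvDl !dotvZl -/(sqnorm (gradf y)) (dotvC v).
have Lg : L * gam ^+ 2 * rho <= gam.
  have rL : 0 < rho * L by exact: mulr_gt0.
  move: gam_le; rewrite ler_pdivlMr// => /(ler_wpM2l (ltW gam_gt0)).
  by rewrite mulr1 expr2; congr (_ <= _); ring.
(* The step-size condition contributes [gam / 2] and the identity [eta2] contributes [gam / 4].
   Against the [- gam] of the linear term this leaves [- gam / 4] times [sqnorm (gradf y)], which PL
   turns into [- m * (f y - fstar)]. *)
have cr : c * rho <= 3 / 4 * gam.
  by have := eta2; rewrite /c => E; lra.
have := ler_wpM2r (sqnorm_ge0 (gradf y)) cr.
have := ler_wpM2l (ltW gam_gt0) (PL y).
rewrite /m => H1 H2; lra.
Qed.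

Let eta' := m - eta.
Let gam' := gam + eta.
Let step := cn_step G eta eta' gam gam'.

Lemma measurable_lyapunov_step dY (Y : measurableType dY) (a D : Y -> R) (v : Y -> Xi)
    (p : Y -> 'rV[R]_d * 'rV[R]_d) :
  measurable_fun setT a -> measurable_fun setT D -> measurable_fun setT v ->
  (forall i, measurable_fun setT (fun y => (p y).1 0 i)) ->
  (forall i, measurable_fun setT (fun y => (p y).2 0 i)) ->
  measurable_fun setT (fun y => (expR (a y) * lyapunov (step (D y) (v y) (p y)))%:E).
Proof.
move=> ma mD mv mp1 mp2.
have [m1 m2] := measurable_cn_step (s := fun y => step (D y) (v y) (p y))
  mG mD mv mp1 mp2 (fun=> erefl).
apply/measurable_EFinP; apply: measurable_funM; last exact: measurable_lyapunov.
exact: (measurableT_comp (@measurable_expR R)).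
Qed.

(* Outside the single time at which the denominator of [cn_step] vanishes, the
   continuous part of the step contracts [z - x] by [expR (- m * t)]. *)
Lemma lyapunov_stepE t s x z :
  eta' + eta * expR (- m * t) != 0 ->
  let y := x + (eta / m * (1 - expR (- m * t))) *: (z - x) in
  lyapunov (step t s (x, z)) =
  f (y - gam *: G y s) - fstar + sqnorm (expR (- m * t) *: (z - x) - eta *: G y s) / 2.
Proof.
move=> D0 y; have mE : eta + eta' = m by rewrite /eta' addrCA subrr addr0.
rewrite /lyapunov /step /cn_step /= mE -/y; congr (_ + sqnorm _ / 2).
set e := expR _ in D0 y *; set g := G y s.
have m0 : m != 0 by rewrite gt_eqF.
move: D0; rewrite /gam' /eta' => D0; clearbody g; apply/rowP => i; rewrite !mxE.
by field; rewrite m0.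
Qed.

Lemma expected_step_le a x z :
  (\int[lebesgue_measure]_(t in `[0%R, +oo[)
     ((\int[PXi]_s (expR (a + m * t) * lyapunov (step t s (x, z)))%:E) *
      (expR (- t))%:E) <= (expR a * lyapunov (x, z))%:E)%E.
Proof.
pose w := z - x.
(* After a waiting time [t] the flow has moved [x] to [x + tau t *: w]. The exponent [a] will be
   [m * T k w]. *)
pose tau t := eta / m * (1 - expR (- m * t)).
pose g r := f (x + r *: w).
pose g' r := dotv (gradf (x + r *: w)) w.
pose h t := expR (a + (m - 1) * t) * ((1 - m) * (g (tau t) - fstar) +
  (1 + m) / 2 * (expR (- m * t) ^+ 2 * sqnorm w) - eta * expR (- m * t) * g' (tau t)).
pose H t := expR (a + (m - 1) * t) * (g (tau t) - fstar +
  expR (- m * t) ^+ 2 * sqnorm w / 2).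
have dg (r : R) : is_derive r 1 g (g' r) by exact: is_derive_along_line.
(* Smoothness between two points of the line is the one-sided quadratic bound on [g] with constant
   [L / 2 * sqnorm w]. *)
have cg' : continuous g'.
  apply: (semiconcave_derive_continuous (C := L / 2 * sqnorm w) dg) => s t.
  have := smooth (x + s *: w) (x + t *: w).
  rewrite (_ : x + s *: w - (x + t *: w) = (s - t) *: w); last first.
    by rewrite scalerBl opprD addrACA subrr add0r.
  rewrite dotvZr sqnormZ /g /g' => P; lra.
have dexp (c b t : R) : is_derive t 1 (fun t => expR (c + b * t)) (expR (c + b * t) * b).
  apply: (is_derive1_comp (f := expR) (g := fun t => c + b * t)).
  have : is_derive t 1 (cst c + b *: @id R) (0 + b *: 1) by exact: is_deriveD.
  by move/is_derive_eq; apply; rewrite add0r [LHS]mulr1.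
have de (t : R) : is_derive t 1 (fun t => expR (- m * t)) (expR (- m * t) * - m).
  by have := dexp 0 (- m) t; under eq_fun do rewrite add0r; rewrite add0r.
have dtau (t : R) : is_derive t 1 tau (eta * expR (- m * t)).
  have := is_deriveZ (eta / m) (is_deriveB (is_derive_cst (1 : R) t 1) (de t)).
  by move/is_derive_eq; apply; rewrite /GRing.scale /=; field; rewrite gt_eqF.
have dgtau (t : R) : is_derive t 1 (g \o tau) (g' (tau t) * (eta * expR (- m * t))).
  exact: is_derive1_comp.
have dH (t : R) : is_derive t 1 H (- h t).
  pose B r := g (tau r) - fstar + sqnorm w / 2 * (expR (- m * r) * expR (- m * r)).
  have dB : is_derive t 1 B _ :=
    is_deriveD (is_deriveB (dgtau t) (is_derive_cst fstar t 1))
      (is_deriveZ (sqnorm w / 2) (is_deriveM (de t) (de t))).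
  have := is_deriveM (dexp a (m - 1) t) dB.
  rewrite (_ : _ * _ = H); last first.
    apply/funext => r; transitivity (expR (a + (m - 1) * r) * B r) => //.
    by rewrite /H /B; ring.
  by move/is_derive_eq; apply; rewrite /h /B /GRing.scale /=; ring.
have ch : continuous h.
  pose E t := expR (- m * t).
  have cE : continuous E by exact: is_derive_continuous de.
  have ctau : continuous tau by exact: is_derive_continuous dtau.
  have cgt : continuous (g \o tau) by exact: is_derive_continuous dgtau.
  have cg't : continuous (g' \o tau) by move=> t; apply: continuous_comp; [exact: ctau|exact: cg'].
  have cA : continuous (fun t => expR (a + (m - 1) * t)).
    exact: is_derive_continuous (dexp a (m - 1)).
  move=> t; apply: cvgM; first exact: cA.
  apply: cvgB.
    apply: cvgD.
      by apply: cvgM; [exact: cvg_cst|apply: cvgB; [exact: cgt|exact: cvg_cst]].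
    apply: cvgM; first exact: cvg_cst.
    apply: cvgM; last exact: cvg_cst.
    by apply: cvgM; exact: cE.
  apply: cvgM; last exact: cg't.
  by apply: cvgM; [exact: cvg_cst|exact: cE].
have H0 t : 0 <= H t.
  rewrite mulr_ge0 ?expR_ge0// addr_ge0 ?subr_ge0 ?fstar_le//.
  by rewrite divr_ge0// mulr_ge0 ?sqr_ge0// sqnorm_ge0.
have jump t : (\int[PXi]_s (expR (a + m * t) *
    (f (x + tau t *: w - gam *: G (x + tau t *: w) s) - fstar
     + sqnorm (expR (- m * t) *: w - eta *: G (x + tau t *: w) s) / 2))%:E *
      (expR (- t))%:E <= (h t)%:E)%E.
  under eq_integral do rewrite EFinM.
  rewrite ge0_integralZl_EFin ?expR_ge0//; last 2 first.
  - by move=> s _; rewrite lee_fin addr_ge0 ?subr_ge0// divr_ge0// sqnorm_ge0.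
  - by apply/measurable_EFinP; exact: measurable_jump.
  have J := expected_jump_le (x + tau t *: w) (expR (- m * t) *: w).
  apply: (@le_trans _ _ ((expR (a + m * t))%:E * _ * (expR (- t))%:E)%E).
    apply: lee_wpmul2r; first by rewrite lee_fin expR_ge0.
    by apply: lee_wpmul2l J; rewrite lee_fin expR_ge0.
  rewrite -!EFinM lee_fin mulrAC -expRD (_ : a + m * t + - t = a + (m - 1) * t); last by ring.
  rewrite /h ler_wpM2l ?expR_ge0// sqnormZ dotvZr -/(g _) -/(g' _).
  (* This is twice the slack between [h] and the jump bound: differentiating the squared norm in [H]
     yields the coefficient [(1 + m) / 2], where the jump only requires [1 / 2]. *)
  have : 0 <= m * (expR (- m * t) ^+ 2 * sqnorm w).
    by rewrite mulr_ge0 ?(ltW m_gt0)// mulr_ge0 ?sqr_ge0// sqnorm_ge0.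
  by move=> P; lra.
(* The cross term of [h] has no definite sign; nonnegativity follows because [h] dominates an
   integral of nonnegative energies. *)
have h0 t : 0 <= t -> 0 <= h t.
  move=> _; rewrite -lee_fin; apply: le_trans (jump t).
  rewrite mule_ge0 ?lee_fin ?expR_ge0//; apply: integral_ge0 => s _.
  by rewrite lee_fin mulr_ge0 ?expR_ge0// addr_ge0 ?subr_ge0// divr_ge0// sqnorm_ge0.
have -> : expR a * lyapunov (x, z) = H 0.
  rewrite /H /lyapunov /tau /g /= !mulr0 addr0 expR0 subrr mulr0 scale0r addr0.
  by rewrite expr1n mul1r.
apply: le_trans (ge0_integral_Nderive_le dH ch h0 H0).
apply: ae_ge0_le_integral => //.
- move=> t _; rewrite mule_ge0 ?lee_fin ?expR_ge0//; apply: integral_ge0 => s _.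
  by rewrite lee_fin mulr_ge0 ?expR_ge0// lyapunov_ge0.
- apply: measurable_funTS; apply: emeasurable_funM.
    pose F (p : R * Xi) := (expR (a + m * p.1) * lyapunov (step p.1 p.2 (x, z)))%:E.
    apply: (measurable_fun_fubini_tonelli_F (m2 := PXi) F).
      apply: measurable_lyapunov_step => //.
      by apply: measurable_funD => //; apply: measurable_funM.
    by move=> p; rewrite lee_fin mulr_ge0 ?expR_ge0// lyapunov_ge0.
  apply/measurable_EFinP; apply: (measurableT_comp (@measurable_expR R)).
  exact: measurable_funN.
- by move=> t; rewrite /= in_itv/= andbT lee_fin => /h0.
- apply/measurable_EFinP; apply: measurable_funTS.
  exact: continuous_measurable_fun.
(* The only time at which the denominator of the step can vanish; a singleton is Lebesgue-null, so
   the comparison with [h] holds almost everywhere. *)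
exists [set - ln (- eta' / eta) / m]; split.
- exact: measurable_set1.
- exact: lebesgue_measure_set1.
move=> t /=; apply: contra_notP => tN _.
have D0 : eta' + eta * expR (- m * t) != 0.
  apply/eqP => E0; apply: tN.
  have -> : - eta' / eta = expR (- m * t).
    by rewrite -[- eta']addr0 -E0; field; rewrite gt_eqF.
  by rewrite expRK; field; rewrite gt_eqF.
apply: le_trans (jump t); apply: lee_wpmul2r; first by rewrite lee_fin expR_ge0.
by under eq_integral do rewrite lyapunov_stepE//.
Qed.

(** * Iteration along the random process *)

Context dO (Omega : measurableType dO) (P : probability Omega R).
Context (Delta : nat -> Omega -> R) (xi : nat -> Omega -> Xi) (x0 : 'rV[R]_d).
Hypothesis mDelta : forall k, measurable_fun setT (Delta k).
Hypothesis DeltaE : forall k A, measurable A -> P (Delta k @^-1` A) = exponential_prob 1 A.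
Hypothesis mxi : forall k, measurable_fun setT (xi k.+1).
Hypothesis xiE : forall k A, measurable A -> P (xi k.+1 @^-1` A) = PXi A.
Hypothesis indep : mutually_independent P Delta xi.

Let T k w := arrival_time (fun i => Delta i w) k.
Let u k w := cn_iter G eta eta' gam gam' (fun i => Delta i w) (fun i => xi i w) x0 k.

(** The source [Y] is arbitrary and only indices up to step [k] are constrained, so that this
    applies both to [Omega] and to [past_type]. *)
Lemma measurable_cn_iter dY (Y : measurableType dY) (D : nat -> Y -> R)
    (X : nat -> Y -> Xi) k :
  (forall i, (i < k)%N -> measurable_fun setT (D i)) ->
  (forall i, (i < k)%N -> measurable_fun setT (X i.+1)) ->
  let p y := cn_iter G eta eta' gam gam' (fun i => D i y) (fun i => X i y) x0 k in
  (forall i, measurable_fun setT (fun y => (p y).1 0 i)) /\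
  (forall i, measurable_fun setT (fun y => (p y).2 0 i)).
Proof.
elim: k => [|k IH] mD mX /=; first by split=> i; exact: measurable_cst.
have [m1 m2] := IH (fun i ik => mD i (leqW ik)) (fun i ik => mX i (leqW ik)).
exact: (measurable_cn_step mG (mD k (ltnSn k)) (mX k (ltnSn k)) m1 m2 (fun=> erefl)).
Qed.

Lemma expected_lyapunov_le k :
  (\int[P]_w (expR (m * T k w) * lyapunov (u k w))%:E <= (f x0 - fstar)%:E)%E.
Proof.
elim: k => [|k IH].
  rewrite (eq_integral (cst (f x0 - fstar)%:E)) => [|w _].
    by rewrite integral_cst//= probability_setT mule1.
  rewrite /T /arrival_time big_ord0 mulr0 expR0 mul1r /lyapunov /= subrr.
  by rewrite /sqnorm /dotv big1 ?mul0r ?addr0// => i _; rewrite mxE mul0r.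
apply: le_trans IH.
have TS w : T k.+1 w = T k w + Delta k w by rewrite /T /arrival_time big_ord_recr.
(* [lebesgue_measure] is a measure on [measurableTypeR R], whose display differs
   from that of [R], so the law of [Delta k] is taken there. *)
pose TR := measurableTypeR R.
(* [Y1] is what is known just before the sample [xi k.+1] is drawn, [Y2] what is known just before
   the waiting time [Delta k]. *)
pose Y1 := past_type Delta xi k.+1 k; pose Y2 := past_type Delta xi k k.
have mu1 n : let Y := past_type Delta xi n k in (k <= n)%N ->
    [/\ measurable_fun setT (T k : Y -> R),
        forall i, measurable_fun setT (fun w : Y => (u k w).1 0 i) &
        forall i, measurable_fun setT (fun w : Y => (u k w).2 0 i)].
  move=> Y kn.
  have mD i : (i < k)%N -> measurable_fun setT (Delta i : Y -> R).
    by move=> ik; apply: measurable_Delta_past; exact: leq_trans kn.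
  have mX i : (i < k)%N -> measurable_fun setT (xi i.+1 : Y -> Xi).
    exact: measurable_xi_past.
  have [m1 m2] := measurable_cn_iter mD mX.
  split=> //; apply: measurable_sum => i; exact: mD.
have [mT1 mu11 mu12] := mu1 k.+1 (leqnSn k).
have [mT2 mu21 mu22] := mu1 k (leqnn k).
(* [F1] frees only the sample; [F2] is the same integrand with the waiting time freed as well. *)
pose F1 (p : Y1 * Xi) := (expR (m * (T k p.1 + Delta k p.1)) *
  lyapunov (step (Delta k p.1) p.2 (u k p.1)))%:E.
pose F2 (p : (Y2 * TR) * Xi) := (expR (m * T k p.1.1 + m * p.1.2) *
  lyapunov (step p.1.2 p.2 (u k p.1.1)))%:E.
have mDk : measurable_fun setT (Delta k : Y1 -> R) by exact: measurable_Delta_past.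
have F10 p : (0 <= F1 p)%E by rewrite lee_fin mulr_ge0 ?expR_ge0// lyapunov_ge0.
have F20 p : (0 <= F2 p)%E by rewrite lee_fin mulr_ge0 ?expR_ge0// lyapunov_ge0.
have mF1 : measurable_fun setT F1.
  apply: measurable_lyapunov_step.
  - apply: measurable_funM; first exact: measurable_cst.
    by apply: measurable_funD; apply: measurableT_comp.
  - exact: measurableT_comp.
  - exact: measurable_snd.
  - by move=> i; apply: (measurableT_comp (mu11 i)).
  - by move=> i; apply: (measurableT_comp (mu12 i)).
have mF2 : measurable_fun setT F2.
  have m11 : measurable_fun setT (fun p : (Y2 * TR) * Xi => p.1.1) by exact: measurableT_comp.
  have m12 : measurable_fun setT (fun p : (Y2 * TR) * Xi => p.1.2) by exact: measurableT_comp.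
  apply: measurable_lyapunov_step => //.
  - apply: measurable_funD; apply: measurable_funM => //.
    exact: (measurableT_comp mT2).
  - by move=> i; apply: (measurableT_comp (mu21 i)).
  - by move=> i; apply: (measurableT_comp (mu22 i)).
pose F3 (p : Y2 * TR) := (\int[PXi]_s F2 (p, s))%E.
have mF3 : measurable_fun setT F3.
  exact: (measurable_fun_fubini_tonelli_F (m2 := PXi) F2).
have F30 p : (0 <= F3 p)%E by exact: integral_ge0.
have mDk' : measurable_fun setT (Delta k : Omega -> TR) by exact: mDelta.
pose X : {mfun Omega >-> TR} := HB.pack (Delta k : Omega -> TR)
  (isMeasurableFun.Build _ _ _ _ _ mDk').
(* Condition on the past: [xi k.+1] is integrated out first, then [Delta k]. *)
have -> : (\int[P]_w (expR (m * T k.+1 w) * lyapunov (u k.+1 w))%:E =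
    \int[P]_w \int[distribution P X]_t F3 ((w : Y2), t))%E.
  transitivity (\int[P]_w F1 ((w : Y1), xi k.+1 w))%E.
    by apply: eq_integral => w _; rewrite TS.
  rewrite (integral_indep (Q := PXi) (X := fun w : Omega => w : Y1))//; last 2 first.
  - exact: measurable_id_past.
  - by move=> A B mA mB; rewrite -(xiE k)//; exact: (past_indep_xi mDelta mxi indep mA).
  transitivity (\int[P]_w F3 ((w : Y2), Delta k w))%E.
    apply: eq_integral => w _. rewrite /F3; apply: eq_integral => s _.
    by rewrite /F1 /F2 /= (mulrDr m).
  apply: (integral_indep (Q := distribution P X) (X := fun w : Omega => w : Y2)
    (W := Delta k : Omega -> TR)) => //.
  - exact: measurable_id_past.
  - by move=> A B mA mB; exact: (past_indep_Delta mDelta mxi indep mA).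
have mF4 : measurable_fun setT
    (fun w : Y2 => (expR (m * T k w) * lyapunov (u k w))%:E).
  apply/measurable_EFinP; apply: measurable_funM; last exact: measurable_lyapunov.
  apply: (measurableT_comp (@measurable_expR R)).
  by apply: measurable_funM => //; exact: measurable_cst.
have mid : measurable_fun setT (fun w : Omega => w : Y2) by exact: measurable_id_past.
apply: ge0_le_integral => //.
- by move=> w _; exact: integral_ge0.
- exact: (measurableT_comp (measurable_fun_fubini_tonelli_F (m2 := distribution P X)
    F3 mF3 F30) mid).
- exact: (measurableT_comp mF4 mid).
move=> w _.
have mF3w : measurable_fun setT (fun t : TR => F3 (w, t)).
  exact: (measurableT_comp mF3 (measurable_pair1 _)).
have lawX A : measurable A -> distribution P X A = exponential_prob 1 A.
  exact: DeltaE.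
rewrite (integral_exponential lawX mF3w (fun t => F30 (w, t))).
have := expected_step_le (m * T k w) (u k w).1 (u k w).2.
by rewrite -surjective_pairing.
Qed.

(** The energy exceeds the gap by the nonnegative term in [z - x]. *)
Lemma expected_gap_le k :
  (\int[P]_w (expR (m * T k w) * (f (u k w).1 - fstar))%:E <= (f x0 - fstar)%:E)%E.
Proof.
apply: le_trans (expected_lyapunov_le k).
have [mu1 mu2] := measurable_cn_iter (k := k) (fun i _ => mDelta i) (fun i _ => mxi i).
have mT : measurable_fun setT (fun w => expR (m * T k w)).
  apply: (measurableT_comp (@measurable_expR R)); apply: measurable_funM => //.
  by apply: measurable_sum => i; exact: mDelta.
apply: ge0_le_integral => //.
- by move=> w _; rewrite lee_fin mulr_ge0 ?expR_ge0// subr_ge0.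
- apply/measurable_EFinP; apply: measurable_funM => //.
  apply: measurable_funB; last exact: measurable_cst.
  exact: (measurable_fun_continuous_row continuous_f mu1).
- apply/measurable_EFinP; apply: measurable_funM => //.
  exact: (measurable_lyapunov (p := u k)).
by move=> w _; rewrite lee_fin ler_wpM2l ?expR_ge0// lerDl divr_ge0// sqnorm_ge0.
Qed.

End continuized_nesterov.

Theorem theorem2
  (R : realType) (dim : nat)
  (f : 'rV[R]_dim -> R) (gradf : 'rV[R]_dim -> 'rV[R]_dim) (fstar : R)
  (L mu rho : R)
  (dX : measure_display) (Xi : measurableType dX) (PXi : probability Xi R)
  (G : 'rV[R]_dim -> Xi -> 'rV[R]_dim)
  (dO : measure_display) (Omega : measurableType dO) (P : probability Omega R)
  (Delta : nat -> Omega -> R) (xi : nat -> Omega -> Xi)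
  (x0 : 'rV[R]_dim) (gam : R) :
  is_gradient f gradf ->
  (forall x, fstar <= f x) -> (exists x, f x = fstar) ->
  0 < L -> 0 < mu -> 1 <= rho ->
  (* L-smoothness *)
  (forall x y, f x - f y - dotv (gradf y) (x - y) <= L / 2 * sqnorm (x - y)) ->
  (* Polyak-Lojasiewicz *)
  (forall x, sqnorm (gradf x) >= 2 * mu * (f x - fstar)) ->
  (* stochastic gradients: measurability, unbiasedness, strong growth *)
  jointly_measurable G ->
  (forall x j, PXi.-integrable setT (fun s => (G x s 0 j)%:E) /\
     (\int[PXi]_s (G x s 0 j)%:E = (gradf x 0 j)%:E)%E) ->
  (forall x, (\int[PXi]_s (sqnorm (G x s))%:E <= (rho * sqnorm (gradf x))%:E)%E) ->
  (* the random inter-arrival times and samples *)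
  (forall k, measurable_fun setT (Delta k)) ->
  (forall k A, measurable A -> P (Delta k @^-1` A) = exponential_prob 1 A) ->
  (forall k, measurable_fun setT (xi k.+1)) ->
  (forall k A, measurable A -> P (xi k.+1 @^-1` A) = PXi A) ->
  mutually_independent P Delta xi ->
  (* step size and parameters *)
  0 < gam -> gam <= 1 / (rho * L) ->
  let gam' := gam + Num.sqrt (gam / (2 * rho)) in
  let eta := Num.sqrt (gam / (2 * rho)) in
  let eta' := mu * gam / 2 - Num.sqrt (gam / (2 * rho)) in
  forall k : nat,
    (\int[P]_w
       (expR (mu * gam / 2 * arrival_time (fun i => Delta i w) k) *
        (f (cn_iter G eta eta' gam gam' (fun i => Delta i w) (fun i => xi i w)
              x0 k).1 - fstar))%:E
     <= (f x0 - fstar)%:E)%E.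
Proof.
move=> gradient_f fstar_le _ L_gt0 mu_gt0 rho_ge1 smooth PL mG unbiased strong_growth.
move=> mDelta DeltaE mxi xiE indep gam_gt0 gam_le gam' eta eta' k.
exact: (expected_gap_le gradient_f fstar_le L_gt0 mu_gt0 rho_ge1 smooth PL mG
  unbiased strong_growth gam_gt0 gam_le x0 mDelta DeltaE mxi xiE indep k).
Qed.
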